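(* Let $G$ be a graph and let $v\in V(G)$. Then $$\gamma_g(G)-\gamma_g(G-v)\le 2\qquad\text{and}\qquad \gamma_g'(G)-\gamma_g'(G-v)\le 2.$$
   Context: Graphs are finite, simple and undirected. A vertex dominates itself and all its neighbors. The domination game on a graph $G$ is played by two players, Dominator and Staller, who alternately choose a vertex of $G$ such that each chosen vertex dominates at least one vertex that was not dominated by the previously chosen vertices. The game ends when all vertices of $G$ are dominated. Dominator wants the total number of chosen vertices to be as small as possible, Staller wants it to be as large as possible. In Game 1 Dominator moves first; in Game 2 Staller moves first. Assuming both play optimally, $\gamma_g(G)$ (the game domination number) is the total number of vertices chosen in Game 1, and $\gamma_g'(G)$ (the Staller-start game domination number) is the total number of vertices chosen in Game 2. $G-v$ denotes the graph obtained from $G$ by removing the vertex $v$ and all edges incident with it. *)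

(* Defs.v *)
From mathcomp Require Import all_boot.

Set Implicit Arguments.
Unset Strict Implicit.
Unset Printing Implicit Defensive.

Record sgraph := SGraph {
  vertex :> finType;
  edge : rel vertex;
  edge_sym : symmetric edge;
  edge_irr : irreflexive edge
}.

Section DeleteVertex.
Variables (G : sgraph) (v : G).

Definition del_edge : rel {x : G | x != v} :=
  fun x y => edge (val x) (val y).

Lemma del_edge_sym : symmetric del_edge.
Proof. by move=> x y; apply: edge_sym. Qed.

Lemma del_edge_irr : irreflexive del_edge.
Proof. by move=> x; apply: edge_irr. Qed.

Definition delete_vertex : sgraph := SGraph del_edge_sym del_edge_irr.

End DeleteVertex.

Inductive player := Dominator | Staller.

Definition opponent (p : player) : player :=
  if p is Dominator then Staller else Dominator.

Section DominationGame.
Variable G : sgraph.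
Implicit Types (S : {set G}) (p : player) (x y : G).

Definition closed_nbhd x : {set G} := [set y | (y == x) || edge x y].

Definition dominated S : {set G} := \bigcup_(x in S) closed_nbhd x.

(* [S] is the set of vertices chosen so far. *)
Definition legal S x : bool := ~~ (closed_nbhd x \subset dominated S).

(* Minimax value of the position in which the vertices of [S] have been chosen
   and [p] is to move, [n] being a bound on the recursion depth.  The game goes
   on as long as some vertex [x0] is undominated; such an [x0] is itself a legal
   move, as the [arg min]/[arg max] notations require. *)
Fixpoint minimax (n : nat) p S : nat :=
  if n isn't n'.+1 then 0 else
  if [pick x0 | x0 \notin dominated S] isn't Some x0 then 0 else
  let value x := minimax n' (opponent p) (x |: S) in
  (value (if p is Dominator
          then [arg min_(x < x0 | legal S x) value x]
          else [arg max_(x > x0 | legal S x) value x])).+1.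

(* Each move dominates a new vertex, so the depth #|G| is never exhausted: see
   [moves_left_Dominator] and [moves_left_Staller] below. *)
Definition moves_left p S : nat := minimax #|G| p S.

Definition game_dom : nat := moves_left Dominator set0.

Definition game_dom_staller : nat := moves_left Staller set0.

Lemma dominatedU1 x S : dominated (x |: S) = closed_nbhd x :|: dominated S.
Proof. by rewrite /dominated bigcup_setU big_set1. Qed.

Lemma undominated_legal S x : x \notin dominated S -> legal S x.
Proof.
by apply: contra => /subsetP; apply; rewrite inE eqxx.
Qed.

Lemma legal_undominated S x :
  legal S x -> #|~: dominated (x |: S)| < #|~: dominated S|.
Proof.
case/subsetPn => y yx yS; apply: proper_card; rewrite dominatedU1 setCU.
apply/properP; split; first exact: subsetIr.
by exists y; rewrite !inE ?yS //; move: yx; rewrite inE => ->.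
Qed.

Lemma eq_minimax n m p S :
  #|~: dominated S| <= n -> #|~: dominated S| <= m ->
  minimax n p S = minimax m p S.
Proof.
elim: n m p S => [|n IHn] [|m] p S //=.
- rewrite leqn0 cards_eq0 => /eqP S0 _.
  by case: pickP => // x xS; have := in_set0 x; rewrite -S0 inE xS.
- move=> _; rewrite leqn0 cards_eq0 => /eqP S0.
  by case: pickP => // x xS; have := in_set0 x; rewrite -S0 inE xS.
move=> Sn Sm; case: pickP => // x0 /undominated_legal Lx0; congr _.+1.
have E x : legal S x -> minimax n (opponent p) (x |: S)
                      = minimax m (opponent p) (x |: S).
  by move=> /legal_undominated Lx; apply: IHn; rewrite -ltnS;
    apply: leq_trans Lx _.
case: p E => /= E.
- case: arg_minnP => // x Lx xmin; case: arg_minnP => // y Ly ymin.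
  apply/eqP; rewrite eqn_leq; apply/andP; split.
    by apply: leq_trans (xmin y Ly) _; rewrite E.
  by rewrite E //; apply: ymin.
case: arg_maxnP => // x Lx xmax; case: arg_maxnP => // y Ly ymax.
apply/eqP; rewrite eqn_leq; apply/andP; split.
  by rewrite E //; apply: ymax.
by rewrite -E //; apply: xmax.
Qed.

Lemma moves_left_over p S : dominated S = setT -> moves_left p S = 0.
Proof.
rewrite /moves_left => S1; case: #|G| => //= n.
by case: pickP => // x; rewrite S1 inE.
Qed.

Lemma moves_left_Dominator S : dominated S != setT ->
  (exists2 x, legal S x &
    moves_left Dominator S = (moves_left Staller (x |: S)).+1) /\
  (forall x, legal S x ->
    moves_left Dominator S <= (moves_left Staller (x |: S)).+1).
Proof.
rewrite -subTset => /subsetPn[z _ zS].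
rewrite /moves_left; have := max_card (mem (~: dominated S)).
have: 0 < #|G| by apply/card_gt0P; exists z.
case EG: #|G| => [//|n] _ Sn.
have E x : legal S x -> minimax n Staller (x |: S)
                      = minimax n.+1 Staller (x |: S).
  move=> /legal_undominated Lx; have Ln: #|~: dominated (x |: S)| <= n.
    by rewrite -ltnS; apply: leq_trans Lx _.
  by apply: eq_minimax => //; apply: leqW.
rewrite [minimax n.+1 Dominator S]/=.
case: pickP => [x0 /undominated_legal Lx0|/(_ z)]; last by rewrite zS.
case: arg_minnP => // x Lx xmin; split; first by exists x; rewrite ?E.
by move=> y Ly; rewrite ltnS -(E y) // xmin.
Qed.

Lemma moves_left_Staller S : dominated S != setT ->
  (exists2 x, legal S x &
    moves_left Staller S = (moves_left Dominator (x |: S)).+1) /\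
  (forall x, legal S x ->
    (moves_left Dominator (x |: S)).+1 <= moves_left Staller S).
Proof.
rewrite -subTset => /subsetPn[z _ zS].
rewrite /moves_left; have := max_card (mem (~: dominated S)).
have: 0 < #|G| by apply/card_gt0P; exists z.
case EG: #|G| => [//|n] _ Sn.
have E x : legal S x -> minimax n Dominator (x |: S)
                      = minimax n.+1 Dominator (x |: S).
  move=> /legal_undominated Lx; have Ln: #|~: dominated (x |: S)| <= n.
    by rewrite -ltnS; apply: leq_trans Lx _.
  by apply: eq_minimax => //; apply: leqW.
rewrite [minimax n.+1 Staller S]/=.
case: pickP => [x0 /undominated_legal Lx0|/(_ z)]; last by rewrite zS.
case: arg_maxnP => // x Lx xmax; split; first by exists x; rewrite ?E.
by move=> y Ly; rewrite ltnS -(E y) //; apply: xmax.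
Qed.

End DominationGame.

(* Main.v *)
(** The Continuation Principle holds: more dominated vertices never lengthen the
    game.  Dominator plays on [G] by copying an optimal play on [G - v], which
    also answers every move of Staller that is legal on [G - v].  The first time
    Staller's move has no legal copy, Dominator replies with [v] (or with any
    move, if [v] is illegal).  From then on the closed neighborhood of [v] is
    dominated, every later move of Staller has a legal copy, and the two games
    are in step again, with only two extra moves having been made on [G]. *)

Require Import Defs.
From mathcomp Require Import all_boot all_order all_algebra.
From mathcomp Require Import zify.

Section ContinuationPrinciple.
Variable G : sgraph.
Implicit Types (S T : {set G}) (p : player) (x y : G).

(** Induction on the number of vertices undominated after [S]. Dominator answers on [T] with the
    optimal move for [S], or with any legal move if that one would add nothing; Staller's optimal
    move on [T] is also legal on [S]. *)
Lemma moves_left_continuation p S T :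
  dominated S \subset dominated T -> moves_left p T <= moves_left p S.
Proof.
have [n] := ubnP #|~: dominated S|.
elim: n p S T => // n IHn p S T Sn ST.
have [/moves_left_over -> //|Tfull] := eqVneq (dominated T) setT.
have Sfull : dominated S != setT.
  by apply: contra Tfull => /eqP S1; rewrite -subTset -S1.
have IH q x T' : legal S x -> dominated (x |: S) \subset dominated T' ->
    moves_left q T' <= moves_left q (x |: S).
  by move=> Lx; apply: IHn; move: (legal_undominated Lx) Sn; lia.
case: p.
- have [[x Lx ->] _] := moves_left_Dominator Sfull.
  have [[z Lz _] le_T] := moves_left_Dominator Tfull.
  have [LTx|] := boolP (legal T x).
    apply: leq_trans (le_T _ LTx) _; rewrite ltnS IH //.
    by rewrite !dominatedU1 setUS.
  rewrite negbK => xT; apply: leq_trans (le_T _ Lz) _; rewrite ltnS IH //.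
  by rewrite !dominatedU1 subUset !subsetU ?xT ?ST ?orbT.
have [[x Lx ->] _] := moves_left_Staller Tfull.
have LSx : legal S x by apply: contra Lx => /subset_trans; apply.
apply: leq_trans ((moves_left_Staller Sfull).2 x LSx).
by rewrite ltnS IH // !dominatedU1 setUS.
Qed.

(** Spares legality checks on Dominator's copied moves: by continuation, any legal move is at least
    as good for Dominator as passing with an illegal [x]. *)
Lemma moves_left_Dominator_le S x :
  moves_left Dominator S <= (moves_left Staller (x |: S)).+1.
Proof.
have [/moves_left_over -> //|Sfull] := eqVneq (dominated S) setT.
have [[z Lz _] le_S] := moves_left_Dominator Sfull.
have [/le_S //|] := boolP (legal S x); rewrite negbK => xS.
apply: leq_trans (le_S z Lz) _; rewrite ltnS moves_left_continuation //.
by rewrite !dominatedU1 (setUidPr xS) subsetUr.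
Qed.

End ContinuationPrinciple.

Section VertexRemoval.
Variables (G : sgraph) (v : G).
Notation Gv := (delete_vertex v).
Implicit Types (S : {set G}) (T : {set Gv}) (p : player).

(** The invariant kept between the two games; it is one-sided and leaves the status of [v] open. *)
Definition dominates_copy S T : Prop :=
  forall y : Gv, y \in dominated T -> val y \in dominated S.

Lemma dominates_copyU1 S T (x : Gv) :
  dominates_copy S T -> dominates_copy (val x |: S) (x |: T).
Proof.
move=> ST y; rewrite !dominatedU1 !inE => /orP[|/ST ->]; last by rewrite orbT.
by rewrite /= /del_edge -val_eqE => ->.
Qed.

Lemma dominates_copyUl S T (x : G) :
  dominates_copy S T -> dominates_copy (x |: S) T.
Proof. by move=> ST y /ST; rewrite dominatedU1 inE orbC => ->. Qed.

(** Neither [x] nor a vertex it newly dominates can be [v], so both survive in [Gv]. *)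
Lemma legal_copy S T x : closed_nbhd v \subset dominated S ->
  dominates_copy S T -> legal S x -> exists2 x' : Gv, val x' = x & legal T x'.
Proof.
move=> vS ST Lx; have xv : x != v by apply: contraNneq Lx => ->.
exists (Sub x xv) => //; case/subsetPn: Lx => y yx yS.
have yv : y != v.
  by apply: contraNneq yS => ->; apply: (subsetP vS); rewrite inE eqxx.
apply/subsetPn; exists (Sub y yv : Gv); last by apply: contra yS => /ST.
by move: yx; rewrite !inE.
Qed.

Lemma moves_left_delete_nbhd p S T : closed_nbhd v \subset dominated S ->
  dominates_copy S T -> moves_left p S <= moves_left p T.
Proof.
have [n] := ubnP #|~: dominated T|.
elim: n p S T => // n IHn p S T Tn vS ST.
have [/moves_left_over -> //|Sfull] := eqVneq (dominated S) setT.
have Tfull : dominated T != setT.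
  (* Used only to obtain a legal move, whoever is to play. *)
  have [[x Lx _] _] := moves_left_Staller Sfull.
  have [x' _] := legal_copy _ _ _ vS ST Lx.
  by apply: contraTneq; rewrite /legal => ->; rewrite subsetT.
have IH q (x : Gv) : legal T x ->
    moves_left q (val x |: S) <= moves_left q (x |: T).
  move=> Lx; apply: IHn; last exact: dominates_copyU1.
    by move: (legal_undominated Lx) Tn; lia.
  by rewrite dominatedU1 (subset_trans vS) ?subsetUr.
case: p.
  have [[x Lx ->] _] := moves_left_Dominator Tfull.
  by apply: leq_trans (moves_left_Dominator_le _ _ (val x)) _; rewrite ltnS IH.
have [[x Lx ->] _] := moves_left_Staller Sfull.
have [x' <- Lx'] := legal_copy _ _ _ vS ST Lx.
by apply: leq_trans ((moves_left_Staller Tfull).2 x' Lx'); rewrite ltnS IH.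
Qed.

Lemma moves_left_play_removed S T : dominates_copy S T ->
  moves_left Dominator S <= (moves_left Staller T).+1.
Proof.
move=> ST; apply: leq_trans (moves_left_Dominator_le _ _ v) _.
rewrite ltnS moves_left_delete_nbhd ?dominatedU1 ?subsetUl //.
exact: dominates_copyUl.
Qed.

Lemma moves_left_delete p S T : dominates_copy S T ->
  moves_left p S <= (moves_left p T).+2.
Proof.
have [n] := ubnP #|~: dominated T|.
elim: n p S T => // n IHn p S T Tn ST.
have IH q (x : Gv) : legal T x ->
    moves_left q (val x |: S) <= (moves_left q (x |: T)).+2.
  move=> Lx; apply: IHn; last exact: dominates_copyU1.
  by move: (legal_undominated Lx) Tn; lia.
case: p.
  have [T1|Tfull] := eqVneq (dominated T) setT.
    (* Only [v] can still be undominated on [G], so one move at most remains. *)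
    apply: leq_trans (moves_left_play_removed _ _ ST) _.
    by rewrite !(moves_left_over _ T1).
  have [[x Lx ->] _] := moves_left_Dominator Tfull.
  by apply: leq_trans (moves_left_Dominator_le _ _ (val x)) _; rewrite ltnS IH.
have [/moves_left_over -> //|Sfull] := eqVneq (dominated S) setT.
have [[x _ ->] _] := moves_left_Staller Sfull.
have [/existsP[x' /andP[/eqP <- Lx']]|_] :=
  boolP [exists x' : Gv, (val x' == x) && legal T x'].
  have Tfull : dominated T != setT.
    by apply: contraTneq Lx'; rewrite /legal => ->; rewrite subsetT.
  have := (moves_left_Staller Tfull).2 x' Lx'.
  by move: (IH Dominator _ Lx'); lia.
(* Here [x] is [v], or [v] is all that [x] newly dominates. The two extra moves are [x] and the
   reply [v]; [T] is unchanged and Staller is to move in both games. *)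
by rewrite ltnS moves_left_play_removed //; apply: dominates_copyUl.
Qed.

End VertexRemoval.

Theorem theorem3p1 (G : sgraph) (v : G) :
  ((game_dom G)%:Z - (game_dom (delete_vertex v))%:Z <= 2)%R /\
  ((game_dom_staller G)%:Z - (game_dom_staller (delete_vertex v))%:Z <= 2)%R.
Proof.
have ST : dominates_copy G v set0 set0.
  by move=> y; rewrite /dominated big_set0 inE.
have := moves_left_delete G v Dominator _ _ ST.
have := moves_left_delete G v Staller _ _ ST.
by rewrite /game_dom /game_dom_staller; lia.
Qed.
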